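(* Let $a<b$ and $\gamma<\Gamma$ be real numbers and let $g:[a,b]\to\mathbb{R}$ be an absolutely continuous function with $\gamma\le g'(t)\le\Gamma$ for almost every $t\in[a,b]$, and such that $t\mapsto (x-t)g'(t)$ is integrable on $[a,b]$ for every $x\in[a,b]$. Put $\lambda=\frac{g(b)-g(a)-\gamma(b-a)}{\Gamma-\gamma}$. Then for all $x\in[a,b]$, $$\left|\frac{1}{b-a}\int_a^b g(t)\,dt-\frac{(x-a)g(a)+(b-x)g(b)}{b-a}-\frac{g(b)-g(a)}{b-a}\left(x-\frac{a+b}{2}\right)\right|\le\frac{\Gamma-\gamma}{2}\cdot\lambda\cdot\frac{b-a-\lambda}{b-a}\le\frac{(\Gamma-\gamma)(b-a)}{8}.$$ In particular, for $x=\frac{a+b}{2}$, $$\left|\frac{1}{b-a}\int_a^b g(t)\,dt-\frac{g(a)+g(b)}{2}\right|\le\frac{\Gamma-\gamma}{2}\cdot\lambda\cdot\frac{b-a-\lambda}{b-a}\le\frac{(\Gamma-\gamma)(b-a)}{8}.$$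
   Context: An absolutely continuous function is differentiable almost everywhere; $g'$ denotes its almost-everywhere derivative, and bounds on $g'$ are understood almost everywhere. *)

(* Defs.v *)
From mathcomp Require Import all_boot all_order all_algebra.
From mathcomp Require Import all_classical all_reals all_analysis.

Set Implicit Arguments.
Unset Strict Implicit.
Unset Printing Implicit Defensive.

Import Order.TTheory GRing.Theory Num.Theory.
Import numFieldNormedType.Exports.

Local Open Scope classical_set_scope.
Local Open Scope ring_scope.

(* A function on [a, b] is represented by a total [g : R -> R]; only its values
   on [a, b] are constrained. *)
Definition absolutely_continuous (R : realType) (a b : R) (g : R -> R) : Prop :=
  forall e : R, 0 < e -> exists2 d : R, 0 < d &
    forall (n : nat) (u v : 'I_n -> R),
      (forall i, [/\ a <= u i, u i < v i & v i <= b]) ->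
      trivIset [set: 'I_n] (fun i => `]u i, v i[%classic) ->
      \sum_(i < n) (v i - u i) < d ->
      \sum_(i < n) `|g (v i) - g (u i)| < e.

(* Main.v *)
From HB Require Import structures.
Require Import Defs.
From mathcomp Require Import all_boot all_order all_algebra.
From mathcomp Require Import all_classical all_reals all_analysis.
From mathcomp Require Import measurable_realfun ring lra.

Set Implicit Arguments.
Unset Strict Implicit.
Unset Printing Implicit Defensive.

Import Order.TTheory GRing.Theory Num.Theory.
Import numFieldNormedType.Exports.

Local Open Scope classical_set_scope.
Local Open Scope ring_scope.

(* The quantity inside the absolute value does not depend on [x]: it is the
   trapezoid error [(1 / (b - a)) * int g - (g a + g b) / 2]. If every slope of
   [g] lies in [gamma, Gamma], then [g] is below two lines, one through
   [(a, g a)] with slope [Gamma] and one through [(b, g b)] with slope [gamma];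
   they cross at [a + lambda], and integrating their minimum gives the upper
   bound. The lower bound is the same statement for [- g].

   The slope bounds need the fundamental theorem of calculus for absolutely
   continuous functions: [g] is the difference of its total variation [V] and
   of [V - g], both nondecreasing and absolutely continuous; their
   Lebesgue-Stieltjes measures are dominated by the Lebesgue measure, hence have
   Radon-Nikodym densities, and by Lebesgue's differentiation theorem the
   difference of these densities is [g'] almost everywhere. In particular [g]
   is differentiable almost everywhere, so that the junk values of [g^`()] at
   points of non-differentiability are harmless. *)

(** * Absolute continuity on the whole line, and extension from an interval *)

Definition itv_disj (R : realType) (p q : R * R) : bool :=
  (p.2 <= q.1) || (q.2 <= p.1).

(* The bound on the variation is weak so that it passes to suprema over
   partitions. *)
Definition ac_line (R : realType) (f : R -> R) : Prop :=
  forall e : R, 0 < e -> exists2 d : R, 0 < d &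
    forall s : seq (R * R),
      all (fun p => p.1 < p.2) s -> pairwise (@itv_disj R) s ->
      \sum_(p <- s) (p.2 - p.1) < d ->
      \sum_(p <- s) `|f p.2 - f p.1| <= e.

(** The nearest-point projection onto [[a, b]]. Composing with it extends a function on [[a, b]] to
    the line by its two boundary values. *)
Definition clamp (R : realType) (a b x : R) : R := Num.min b (Num.max a x).

Section clamp.
Variables (R : realType) (a b : R).
Hypothesis ab : a <= b.

Lemma clamp_ge x : a <= clamp a b x.
Proof. by rewrite /clamp le_min ab le_max lexx. Qed.

Lemma clamp_le x : clamp a b x <= b.
Proof. by rewrite /clamp ge_min lexx. Qed.

Lemma clamp_id x : a <= x <= b -> clamp a b x = x.
Proof. by move=> /andP[ax xb]; rewrite /clamp max_r// min_r. Qed.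

Lemma le_clamp x y : x <= y -> clamp a b x <= clamp a b y.
Proof.
move=> xy; rewrite /clamp le_min ge_min lexx/= ge_min.
by rewrite ge_max !le_max lexx xy/= !orbT.
Qed.

Lemma clampB x y : x <= y -> clamp a b y - clamp a b x <= y - x.
Proof.
move=> xy; rewrite /clamp /Order.min /Order.max.
by do !case: ifPn; rewrite -?leNgt; lra.
Qed.

End clamp.

(** Projecting is monotone and does not increase lengths, so disjointness and total length survive.
    Pairs that collapse to a point contribute zero and are dropped. One [s'] is chosen for all [f],
    because the projection does not depend on [f]. *)
Lemma clamp_family (R : realType) (a b : R) (s : seq (R * R)) :
  a <= b -> all (fun p => p.1 < p.2) s -> pairwise (@itv_disj R) s ->
  exists s' : seq (R * R), [/\
    all (fun p => [&& a <= p.1, p.1 < p.2 & p.2 <= b]) s',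
    pairwise (@itv_disj R) s',
    \sum_(p <- s') (p.2 - p.1) <= \sum_(p <- s) (p.2 - p.1) &
    forall f : R -> R,
      \sum_(p <- s) `|f (clamp a b p.2) - f (clamp a b p.1)| =
      \sum_(p <- s') `|f p.2 - f p.1|].
Proof.
move=> ab s_lt s_disj; pose c := clamp a b.
exists [seq p <- [seq (c p.1, c p.2) | p <- s] | p.1 < p.2]; split.
- apply/allP => p; rewrite mem_filter => /andP[p12 /mapP[q _ pE]].
  by rewrite p12 pE clamp_ge// clamp_le.
- apply: pairwise_filter; rewrite pairwise_map; apply: sub_pairwise s_disj.
  by move=> p q /orP[] pq; apply/orP; [left|right]; exact: le_clamp.
- rewrite big_filter big_map /= big_mkcond/=.
  rewrite !big_seq; apply: ler_sum => p /(allP s_lt)/= p12.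
  case: ifPn => _; first by rewrite clampB// ltW.
  by rewrite subr_ge0 ltW.
- move=> f; rewrite big_filter big_map /= [RHS]big_mkcond/=.
  rewrite !big_seq; apply: eq_bigr => p /(allP s_lt)/= p12.
  case: ifPn => //; rewrite -leNgt => c21.
  suff -> : clamp a b p.1 = clamp a b p.2 by rewrite subrr normr0.
  by apply/eqP; rewrite eq_le c21 le_clamp// ltW.
Qed.

Lemma absolutely_continuous_clamp (R : realType) (a b : R) (g : R -> R) :
  a <= b -> absolutely_continuous a b g -> ac_line (g \o clamp a b).
Proof.
move=> ab acg e e0; have [d d0 gd] := acg e e0.
exists d => // s s_lt s_disj s_d.
have [s' [s'P s'_disj s'_len ->]] := clamp_family ab s_lt s_disj.
rewrite big_tnth; apply: ltW.
pose p := tnth (in_tuple s').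
apply: (gd _ (fun i => (p i).1) (fun i => (p i).2)).
- by move=> i; apply/and3P/(allP s'P)/mem_tnth.
- apply/trivIsetP => /= i j _ _ ij.
  have main (k l : 'I_(size s')) : (k < l)%N -> itv_disj (p k) (p l).
    move=> kl; rewrite /p !(tnth_nth (0, 0))/=.
    by move/pairwiseP : s'_disj => /(_ (0, 0)); apply; rewrite ?inE.
  have {main} dij : itv_disj (p i) (p j).
    have : (i != j :> nat) by [].
    by rewrite neq_ltn => /orP[/main//|/main]; rewrite /itv_disj orbC.
  rewrite -subset0 => x [/=]; rewrite !in_itv/= => /andP[? ?] /andP[? ?].
  by case/orP: dij => h; lra.
- by rewrite -(big_tnth _ _ s' xpredT (fun p => p.2 - p.1)) (le_lt_trans s'_len).
Qed.

(** * Partitions, and the total variation of an absolutely continuous function *)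

Section partition_pairs.
Variable R : realType.
Implicit Types (x y : R) (l : seq R) (f : R -> R).

Lemma pairmap_pair_bounds x y l : itv_partition x y l ->
  all (fun p => [&& x <= p.1, p.1 < p.2 & p.2 <= y]) (pairmap pair x l).
Proof.
elim: l x => //= z l ih x xyl.
have zyl := itv_partition_cons xyl.
have xz : x < z by case: xyl => /= /andP[].
rewrite lexx xz (itv_partition_le zyl)/=.
apply: sub_all (ih _ zyl) => p /and3P[h1 -> ->].
by rewrite (le_trans (ltW xz) h1).
Qed.

Lemma pairmap_pair_disj x y l : itv_partition x y l ->
  pairwise (@itv_disj R) (pairmap pair x l).
Proof.
elim: l x => //= z l ih x xyl.
have zyl := itv_partition_cons xyl.
rewrite (ih _ zyl) andbT; apply: sub_all (pairmap_pair_bounds zyl) => p.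
by rewrite /itv_disj/= => /and3P[-> _ _].
Qed.

Lemma pairmap_pair_length x y l : itv_partition x y l ->
  \sum_(p <- pairmap pair x l) (p.2 - p.1) = y - x.
Proof.
elim: l x => [x /itv_partition_nil -> |z l ih x xyl] /=.
  by rewrite big_nil subrr.
rewrite big_cons (ih _ (itv_partition_cons xyl))/=; lra.
Qed.

Lemma pairmap_pair_variation x y f l : itv_partition x y l ->
  \sum_(p <- pairmap pair x l) `|f p.2 - f p.1| = variation x y f l.
Proof.
rewrite /variation.
elim: l x => [x _|z l ih x xyl] /=.
  by rewrite big_nil big_geq.
by rewrite big_cons (ih _ (itv_partition_cons xyl))/= big_nat_recl.
Qed.

End partition_pairs.

(* The intervals of [s] are replaced one at a time by the pieces of a partition,
   which are moved to [t]. *)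
Lemma sum_total_variation_le (R : realType) (f : R -> R) (e d : R) :
  (forall s : seq (R * R),
      all (fun p => p.1 < p.2) s -> pairwise (@itv_disj R) s ->
      \sum_(p <- s) (p.2 - p.1) < d ->
      \sum_(p <- s) `|f p.2 - f p.1| <= e) ->
  forall s t : seq (R * R),
    all (fun p => p.1 < p.2) (s ++ t) -> pairwise (@itv_disj R) (s ++ t) ->
    \sum_(p <- s ++ t) (p.2 - p.1) < d ->
    (\sum_(p <- s) total_variation p.1 p.2 f +
     (\sum_(p <- t) `|f p.2 - f p.1|)%:E <= e%:E)%E.
Proof.
move=> fe; elim=> [|p s ih] t.
  by move=> t_lt t_disj t_d; rewrite big_nil add0e lee_fin fe.
move=> /= /andP[p12 st_lt] /andP[p_disj st_disj]; rewrite big_cons => st_d.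
rewrite big_cons.
have S_ge0 : (0 <= \sum_(q <- s) total_variation q.1 q.2 f)%E.
  rewrite big_seq; apply: sume_ge0 => q qs; apply: total_variation_ge0.
  by apply/ltW/(allP st_lt); rewrite mem_cat qs.
have T_ge0 : 0 <= \sum_(q <- t) `|f q.2 - f q.1| by exact: sumr_ge0.
have : (\sum_(q <- s) total_variation q.1 q.2 f +
    (\sum_(q <- t) `|f q.2 - f q.1|)%:E <= e%:E)%E.
  by apply: ih => //; apply: le_lt_trans st_d; rewrite lerDr subr_ge0 ltW.
move=> le_e.
have S_fin : \sum_(q <- s) total_variation q.1 q.2 f \is a fin_num.
  rewrite ge0_fin_numE//; apply: le_lt_trans (ltry e); apply: le_trans le_e.
  by rewrite leeDl// lee_fin.
(* The other terms are finite, so they move to the right-hand side. The supremum defining the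
   variation over [p] can then be bounded one partition at a time. *)
rewrite -addeA -leeBrDr ?fin_numD ?S_fin//.
apply: ge_ereal_sup => _ [_ [l pl <-] <-].
rewrite leeBrDr ?fin_numD ?S_fin// addeCA -EFinD.
rewrite -(pairmap_pair_variation f pl) -big_cat/=.
have lP := pairmap_pair_bounds pl.
apply: ih.
- rewrite all_cat all_cat; move: st_lt; rewrite all_cat => /andP[-> ->].
  by rewrite andbT/=; apply: sub_all lP => q /and3P[].
- move: st_disj; rewrite !pairwise_cat => /and3P[st -> ->].
  rewrite (pairmap_pair_disj pl) /= allrel_catr st andbT.
  have h (q r : R * R) : [&& p.1 <= q.1, q.1 < q.2 & q.2 <= p.2] -> itv_disj p r ->
       itv_disj q r.
    rewrite /itv_disj => /and3P[h1 h2 h3] /orP[|] h; apply/orP.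
      by left; lra.
    by right; lra.
  move: p_disj; rewrite all_cat => /andP[ps pt].
  apply/andP; split.
    apply/allrelP => r q rs ql; rewrite /itv_disj orbC.
    by apply: h (allP lP _ ql) _; exact: (allP ps).
  rewrite andbT.
  apply/allrelP => q r ql rt.
  by apply: h (allP lP _ ql) _; exact: (allP pt).
- apply: le_lt_trans st_d; rewrite !big_cat/= (pairmap_pair_length pl).
  by rewrite addrCA.
Qed.

Section variation_function.
Variables (R : realType) (a b : R) (f : R -> R).
Hypotheses (ab : a <= b) (acf : ac_line f).

(** An interval shorter than the [d] attached to [e = 1] has variation at most 1, and finitely many
    such intervals cover [[x, y]]. *)
Lemma ac_line_TV_fin x y : x <= y -> total_variation x y f \is a fin_num.
Proof.
move=> xy; have [d d0 fd] := acf (@ltr01 R).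
have small u v : u < v -> v - u < d -> total_variation u v f \is a fin_num.
  move=> uv uvd; rewrite ge0_fin_numE; last exact/total_variation_ge0/ltW.
  apply: le_lt_trans (ltry 1); have := sum_total_variation_le fd.
  move=> /(_ [:: (u, v)] [::]); rewrite !big_cons !big_nil ?addr0 ?adde0 /=.
  by rewrite uv; apply.
(* Steps of [d / 2] stay strictly below the threshold [d]; [n] of them exceed the length [y - x]. *)
have [n nxy] : exists n : nat, y - x < n%:R * (d / 2).
  exists (Num.bound ((y - x) / (d / 2))); rewrite -ltr_pdivrMr ?divr_gt0//.
  by apply: archi_boundP; rewrite divr_ge0 ?divr_ge0 ?subr_ge0// ltW.
elim: n x xy nxy => [x xy|n ih x xy]; first by rewrite mul0r; lra.
rewrite -natr1 mulrDl mul1r => nxy.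
have [->|xney] := eqVneq x y; first by rewrite total_variationxx.
have [yxd|dyx] := ltP (y - x) d.
  by apply: small => //; rewrite lt_neqAle xney.
rewrite (@total_variationD _ x y (x + d / 2)); [|lra|lra].
by rewrite fin_numD small ?ih//; lra.
Qed.

(** The variation from [a], frozen outside [[a, b]] so as to be nondecreasing on all of the line, as
    a cumulative function must be. *)
Definition tv_fun (x : R) : R := fine (total_variation a (clamp a b x) f).

Lemma tv_funB x y : x <= y -> tv_fun y - tv_fun x =
  fine (total_variation (clamp a b x) (clamp a b y) f).
Proof.
move=> xy; have cxy : clamp a b x <= clamp a b y by exact: le_clamp.
have acx : a <= clamp a b x by exact: clamp_ge.
rewrite /tv_fun (total_variationD _ acx cxy) fineD ?ac_line_TV_fin//.
by rewrite addrAC subrr add0r.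
Qed.

Lemma tv_fun_ge x y : x <= y ->
  `|f (clamp a b y) - f (clamp a b x)| <= tv_fun y - tv_fun x.
Proof.
move=> xy; have cxy : clamp a b x <= clamp a b y by exact: le_clamp.
by rewrite tv_funB// -lee_fin fineK ?ac_line_TV_fin// total_variation_ge.
Qed.

Lemma ac_line_tv_fun : ac_line tv_fun.
Proof.
move=> e e0; have [d d0 fd] := acf e0; exists d => // s s_lt s_disj s_d.
have [s' [s'P s'_disj s'_len sE]] := clamp_family ab s_lt s_disj.
rewrite (sE (fun x => fine (total_variation a x f))).
have := sum_total_variation_le fd.
move=> /(_ s' [::]); rewrite cats0 big_nil adde0 => h.
rewrite -lee_fin; apply: le_trans (h _ _ _) => //; last 2 first.
- by apply: sub_all s'P => p /and3P[].
- exact: le_lt_trans s_d.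
rewrite -sumEFin !big_seq lee_sum// => p /(allP s'P)/and3P[ap p12 pb].
have p12' := ltW p12.
rewrite (total_variationD _ ap p12') fineD ?ac_line_TV_fin//.
rewrite addrAC subrr add0r ger0_norm ?fineK ?ac_line_TV_fin//.
exact/fine_ge0/total_variation_ge0.
Qed.

End variation_function.

Lemma ac_line_continuous (R : realType) (f : R -> R) :
  ac_line f -> continuous f.
Proof.
move=> acf x; apply/cvgrPdist_le => e e0; have [d d0 fd] := acf e e0.
near=> y.
have xyd : `|x - y| < d by near: y; exact: cvgr_dist_lt.
have fd1 u v : u < v -> v - u < d -> `|f v - f u| <= e.
  by move=> uv vu; have := fd [:: (u, v)]; rewrite !big_seq1/= uv; apply.
case: (ltgtP x y) xyd => [xy|yx|->] xyd.
- by rewrite distrC fd1//; move: xyd; rewrite ltr0_norm ?subr_lt0// opprB.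
- by rewrite fd1//; move: xyd; rewrite gtr0_norm// subr_gt0.
- by rewrite subrr normr0 ltW.
Unshelve. all: by end_near. Qed.

(** * Lebesgue-Stieltjes measures dominated by the Lebesgue measure *)

Lemma open_itv_of_finite_measure (R : realType) (I : set R) :
  open I -> is_interval I -> (@lebesgue_measure R I < +oo)%E ->
  exists p : R * R, I = `]p.1, p.2[%classic.
Proof.
move=> oI /is_intervalP; move: (Rhull I) => i IE muI.
have [->|i_neq0] := eqVneq I set0.
  by exists (0, 0); rewrite set_itvoo0.
have i12 : (i.1 < i.2)%O.
  move: i_neq0; rewrite IE; apply: contraNT => i12.
  by case: i i12 {IE} => i1 i2 i12; apply/eqP; exact: set_itv_ge.
(* Finite measure excludes the unbounded intervals; openness of [I] then makes both endpoints
   open. *)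
case: i i12 IE => -[b1 u|[|]] [b2 v|[|]] // i12 IE;
  try by move: muI; rewrite IE lebesgue_measure_itv /= ?ltry ?ltNyr.
by exists (u, v); move/interior_id : oI; rewrite IE interior_itv_bnd.
Qed.

Section stieltjes.
Variables (R : realType) (F : cumulative R R).
Local Notation nu := (lebesgue_stieltjes_measure F).
Local Notation mu := (@lebesgue_measure R).

Lemma stieltjes_itv_oc x y : x <= y -> nu `]x, y]%classic = (F y - F x)%:E.
Proof.
move=> xy; rewrite /lebesgue_stieltjes_measure /measure_extension/=.
by rewrite measurable_mu_extE/= ?wlength_itv_bnd//; exact: is_ocitv.
Qed.

(** Finitely many components of [U] form a family to which the hypothesis applies; the bound then
    passes to the limit of the partial sums. *)
Lemma stieltjes_open_le (e d : R) (U : set R) :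
  (forall s : seq (R * R),
      all (fun p => p.1 < p.2) s -> pairwise (@itv_disj R) s ->
      \sum_(p <- s) (p.2 - p.1) < d ->
      \sum_(p <- s) `|F p.2 - F p.1| <= e) ->
  open U -> (mu U < d%:E)%E -> (nu U <= e%:E)%E.
Proof.
move=> Fd oU muU.
have UE := open_disjoint_itv_bigcup oU.
have I_triv := @open_disjoint_itv_trivIset _ _ oU.
have I_open := @open_disjoint_itv_open _ _ oU.
have I_itv := @open_disjoint_itv_is_interval _ _ oU.
set I := open_disjoint_itv oU in UE I_triv I_open I_itv.
have mI q : measurable (I q) by exact: open_measurable.
have mU : measurable U by exact: open_measurable.
have muI q : (mu (I q) < +oo)%E.
  apply: (@le_lt_trans _ _ (mu U)); last exact: lt_trans muU (ltry _).
  apply: le_measure; rewrite ?inE; [exact: mI|exact: mU|].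
  by rewrite UE; exact: bigcup_sup.
have /choice[p pE] q := open_itv_of_finite_measure (I_open q) (I_itv q) (muI q).
rewrite {1}UE measure_semi_bigcup//; last by rewrite -UE.
apply: lime_le; first by apply: is_cvg_nneseries => q _ _; exact: measure_ge0.
near=> n.
(* Empty components are left out, since the hypothesis asks for nondegenerate intervals. *)
pose s := [seq q <- iota 0 n | (p q).1 < (p q).2].
have muE : (\sum_(q <- s) ((p q).2 - (p q).1)%:E = \sum_(0 <= q < n) mu (I q))%E.
  rewrite big_filter big_mkcond /= /index_iota subn0; apply: eq_bigr => q _.
  by rewrite pE lebesgue_measure_itv/= lte_fin; case: ifPn.
have nuE : (\sum_(0 <= q < n) nu (I q) <=
             \sum_(q <- s) (`|F (p q).2 - F (p q).1|%R)%:E)%E.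
  rewrite big_filter [leRHS]big_mkcond /= /index_iota subn0; apply: lee_sum => q _.
  rewrite pE; case: ifPn => [pq|]; last first.
    by rewrite -leNgt => qp; rewrite set_itv_ge ?measure0// bnd_simp -leNgt.
  (* The right endpoint is added because increments of [F] measure half-open intervals. *)
  apply: (@le_trans _ _ (nu `](p q).1, (p q).2]%classic)).
    apply: le_measure; rewrite ?inE; try exact: measurable_itv.
    by apply: subset_itvl; rewrite bnd_simp.
  by rewrite (stieltjes_itv_oc (ltW pq)) lee_fin ler_norm.
apply: (le_trans nuE); rewrite sumEFin lee_fin.
rewrite -(big_map p xpredT (fun p => `|F p.2 - F p.1|)); apply: Fd.
- by rewrite all_map; apply/allP => q; rewrite mem_filter => /andP[].
- rewrite pairwise_map.
  apply: (@sub_in_pairwise _ (fun q => (p q).1 < (p q).2) ltn); last 2 first.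
  + by rewrite all_filter; apply/allP => q _; exact/implyP.
  + apply: pairwise_filter; rewrite -sorted_pairwise; last exact: ltn_trans.
    exact: iota_ltn_sorted.
  move=> q r; rewrite !unfold_in => pq pr qr.
  (* Otherwise the midpoint of the overlap lies in two components, which forces [q = r] against
     [q < r]. *)
  apply/negPn/negP; rewrite negb_or -!ltNge => /andP[h1 h2].
  have : I q `&` I r !=set0.
    rewrite !pE; exists ((Num.max (p q).1 (p r).1 + Num.min (p q).2 (p r).2) / 2).
    split; rewrite /= in_itv/= /Order.max /Order.min; apply/andP;
    by split; do !case: ifPn; rewrite -?leNgt; lra.
  move=> /I_triv => /(_ Logic.I Logic.I) qrE.
  by rewrite qrE /= ltnn in qr.
- rewrite big_map -lte_fin -sumEFin muE; apply: le_lt_trans muU.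
  rewrite [leRHS](_ : _ = \sum_(0 <= q <oo) mu (I q))%E; last first.
    by rewrite {1}UE measure_semi_bigcup// -UE.
  exact: nneseries_lim_ge.
Unshelve. all: by end_near. Qed.

Lemma stieltjes_dominates : ac_line F -> nu `<< mu.
Proof.
move=> acF; apply/null_content_dominatesP => N mN muN0.
apply/eqP; rewrite eq_le measure_ge0 andbT; apply/lee_addgt0Pr => e e0.
rewrite add0e; have [d d0 Fd] := acF e e0.
(* Outer regularity encloses the null set in an open set of measure below [d], whose Stieltjes
   measure is then at most [e]. *)
have [|U [oU NU UNd]] := @lebesgue_regularity_outer R N d mN _ d0.
  by rewrite [ltLHS]muN0.
apply: (@le_trans _ _ (nu U)).
  by apply: le_measure; rewrite ?inE//; exact: open_measurable.
apply: (stieltjes_open_le Fd) => //.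
rewrite -(setDUK NU).
by apply: le_lt_trans UNd; apply: (le_trans (measureU2 _ _ _)) => //;
  [exact: measurableD (open_measurable oU) mN|rewrite muN0 add0e].
Qed.

End stieltjes.

(** * Densities of absolutely continuous functions, and their derivatives *)

Section density.
Variable R : realType.
Local Notation mu := (@lebesgue_measure R).

(** On [[a, b]], [f] is an indefinite integral of [h]. Integrability on the whole line allows
    integrals from minus infinity, and the half-open intervals are those of Stieltjes measures. *)
Definition has_density (a b : R) (f h : R -> R) : Prop :=
  mu.-integrable setT (EFin \o h) /\
  forall x y, a <= x -> x <= y -> y <= b ->
    f y - f x = \int[mu]_(t in `]x, y]) h t.

Lemma nondecreasing_ac_line_density (a b : R) (F : R -> R) :
  a <= b -> {homo F : x y / x <= y} -> ac_line F ->
  exists h, has_density a b F h.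
Proof.
move=> ab F_nd acF.
have F_rc : right_continuous F.
  by apply: right_continuousW; exact: ac_line_continuous.
pose F' : cumulative R R := HB.pack F (isCumulative.Build R _ R F F_nd F_rc).
pose nu := lebesgue_stieltjes_measure F'.
have mab : measurable (`]a, b]%classic : set (measurableTypeR R)).
  exact: measurable_itv.
have nu_ab : (lebesgue_stieltjes_measure F' `]a, b]%classic < +oo)%E.
  by rewrite stieltjes_itv_oc// ltry.
(* Restricting to []a, b]] gives a finite measure, so the Radon-Nikodym density is integrable on the
   whole line. *)
pose nu' := mfrestr mab nu_ab.
have nu'_mu : nu' `<< mu.
  apply/null_content_dominatesP => N mN N0.
  have /null_content_dominatesP nu_mu := @stieltjes_dominates R F' acF.
  rewrite /nu' /mfrestr /mrestr; apply: nu_mu; first exact: measurableI.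
  by apply: (subset_measure0 _ _ _ N0) => //; exact: measurableI.
have [h [h0 hfin hint hE]] :=
  @radon_nikodym_sigma_finite _ _ _ mu nu' nu'_mu.
exists (fine \o h); split.
  by apply: eq_integrable hint => //= x _; rewrite fineK.
move=> x y ax xy yb.
rewrite /Rintegral; under eq_integral do rewrite /= fineK//.
have : nu' `]x, y]%classic = (\int[mu]_(t in `]x, y]) h t)%E.
  by apply: hE; exact: measurable_itv.
rewrite /nu' /mfrestr /mrestr => <-.
rewrite setIidl ?stieltjes_itv_oc//.
by move=> t /=; rewrite !in_itv/= => /andP[? ?]; apply/andP; split; lra.
Qed.

Lemma has_densityB (a b : R) (f1 f2 h1 h2 : R -> R) :
  has_density a b f1 h1 -> has_density a b f2 h2 ->
  has_density a b (f1 \- f2) (h1 \- h2).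
Proof.
move=> [h1i h1E] [h2i h2E]; split.
  rewrite (_ : _ \o _ = (EFin \o h1) \- (EFin \o h2))%E; last first.
    by apply/funext => x /=; rewrite EFinB.
  exact: integrableB.
move=> x y ax xy yb; rewrite RintegralB//; last 2 first.
- exact: integrableS h1i.
- exact: integrableS h2i.
by rewrite -h1E// -h2E//=; lra.
Qed.

(** Jordan decomposition: [f] is [V - W] on [[a, b]], with [V] and [W] nondecreasing, and their
    densities are subtracted. *)
Lemma ac_line_density (a b : R) (f : R -> R) :
  a <= b -> ac_line f -> exists h, has_density a b f h.
Proof.
move=> ab acf.
pose V := tv_fun a b f; pose W x := V x - f (clamp a b x).
have V_nd : {homo V : x y / x <= y}.
  by move=> x y xy; rewrite -subr_ge0 (le_trans _ (tv_fun_ge ab acf xy)).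
have W_nd : {homo W : x y / x <= y}.
  move=> x y xy; rewrite /W; have := tv_fun_ge ab acf xy.
  by rewrite ler_norml -/V => /andP[_ ?]; lra.
have acV : ac_line V by exact: ac_line_tv_fun.
have acW : ac_line W.
  (* Increments of [W] are at most twice those of [V], hence [e / 2]. *)
  move=> e e0; have e20 : 0 < e / 2 by rewrite divr_gt0.
  have [d d0 Vd] := acV _ e20.
  exists d => // s s_lt s_disj s_d.
  apply: (@le_trans _ _ (\sum_(p <- s) 2 * `|V p.2 - V p.1|)).
    rewrite !big_seq; apply: ler_sum => p /(allP s_lt)/= p12.
    have {}p12 := ltW p12; have := tv_fun_ge ab acf p12; rewrite -/V.
    rewrite (ger0_norm (x := W _ - _)) ?subr_ge0 ?W_nd//.
    rewrite (ger0_norm (x := V _ - _)) ?subr_ge0 ?V_nd//.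
    by rewrite ler_norml /W => /andP[? _]; lra.
  by rewrite -mulr_sumr; have := Vd s s_lt s_disj s_d; lra.
have [hV VE] := nondecreasing_ac_line_density ab V_nd acV.
have [hW WE] := nondecreasing_ac_line_density ab W_nd acW.
exists (hV \- hW); have [VWi VWE] := has_densityB VE WE; split => //.
move=> x y ax xy yb; rewrite -VWE// /W /= !clamp_id//; first lra.
- by apply/andP; split; lra.
- by apply/andP; split; lra.
Qed.

Lemma has_density_derive (a b : R) (f h : R -> R) : has_density a b f h ->
  {ae mu, forall x, a < x < b -> f^`()%classic x = h x}.
Proof.
move=> [hi hE].
have hi' y : mu.-integrable `]-oo, y] (EFin \o h) by exact: integrableS hi.
have hloc : locally_integrable [set: R] h.
  by apply: open_integrable_locally => //; exact: openT.
have := FTC1Ny hi' hloc; apply: filterS; first exact: (ae_filter_ringOfSetsType mu).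
move=> x /= [dH <-] /andP[ax xb].
pose H y := \int[mu]_(t in `]-oo, y]) h t.
rewrite !derive1E.
(* Near an interior point, [f] and the primitive [H] differ by a constant, so the differentiability
   of [H] carries over to [f]. *)
have -> : 'D_1 f x = 'D_1 (H + cst (f x - H x)) x.
  apply: near_eq_derive; near=> y.
  have ay : a < y by near: y; exact: lt_nbhsr.
  have yb : y < b by near: y; exact: lt_nbhsl.
  rewrite !fctE /cst.
  have HB u v : a <= u -> u <= v -> v <= b -> H v - H u = f v - f u.
    by move=> au uv vb; rewrite hE// -(@Rintegral_itvB _ h -oo%O (BRight v) u).
  case: (leP x y) => [xy|/ltW yx].
    by have := HB x y (ltW ax) xy (ltW yb); lra.
  by have := HB y x (ltW ay) yx (ltW xb); lra.
by rewrite deriveD//= derive_cst addr0.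
Unshelve. all: by end_near. Qed.

End density.

(** * Increments under a bound on the density, and integrals of affine functions *)

Section slopes.
Variable R : realType.
Local Notation mu := (@lebesgue_measure R).

Lemma ae_le0_Rintegral (D : set R) (f : R -> R) : measurable D ->
  mu.-integrable D (EFin \o f) -> {ae mu, forall x, D x -> f x <= 0} ->
  \int[mu]_(x in D) f x <= 0.
Proof.
move=> mD fi f_le0; rewrite /Rintegral integralE.
(* The positive part of [f] vanishes almost everywhere on [D], so only the negative part
   contributes. *)
rewrite [X in fine (X - _)](_ : _ = 0%E); last first.
  rewrite -(integral0 mu D); apply: ge0_ae_eq_integral => //.
  - by apply: measurable_funepos; exact: measurable_int fi.
  - move: f_le0; apply: filterS; first exact: (ae_filter_ringOfSetsType mu).
    move=> x f_le0 Dx; by rewrite funeposE/= max_r// lee_fin f_le0.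
rewrite add0e fineN oppr_le0; apply: fine_ge0; exact: integral_ge0.
Qed.

Lemma has_density_le (a b c : R) (f h : R -> R) : has_density a b f h ->
  {ae mu, forall t, a < t < b -> h t <= c} ->
  forall x y, a <= x -> x <= y -> y <= b -> f y - f x <= c * (y - x).
Proof.
move=> [hi hE] h_le x y ax; rewrite le_eqVlt => /predU1P[-> _|xy yb].
  by rewrite !subrr mulr0.
rewrite hE ?(ltW xy)//.
have mxy : measurable (`]x, y[%classic : set (measurableTypeR R)).
  exact: measurable_itv.
have muxy : mu `]x, y[%classic = (y - x)%:E.
  by rewrite lebesgue_measure_itv/= lte_fin xy.
have hi' : mu.-integrable `]x, y[ (EFin \o h) by exact: integrableS hi.
have ci : mu.-integrable `]x, y[ (EFin \o (cst c : R -> R)).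
  apply: measurable_bounded_integrable => //.
  - by rewrite [ltLHS]muxy ltry.
  - exact: bounded_cst.
(* The right endpoint is dropped: it may be [b], where [h_le] gives no bound. *)
rewrite -Rintegral_itv_bndo_bndc// -subr_le0.
have -> : c * (y - x) = \int[mu]_(t in `]x, y[) cst c t.
  by rewrite Rintegral_cst//= muxy.
rewrite -RintegralB//; apply: ae_le0_Rintegral => //.
  rewrite (_ : _ \o _ = (EFin \o h) \- (EFin \o cst c))%E; last first.
    by apply/funext => t /=; rewrite EFinB.
  exact: integrableB.
move: h_le; apply: filterS; first exact: (ae_filter_ringOfSetsType mu).
move=> t h_le; rewrite /= in_itv/= => /andP[xt ty]; rewrite subr_le0 h_le//.
by apply/andP; split; lra.
Qed.

Lemma Rintegral_affine (m k p q : R) : p <= q ->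
  \int[mu]_(t in `[p, q]) (m + k * t) = m * (q - p) + k * (q ^+ 2 - p ^+ 2) / 2.
Proof.
rewrite le_eqVlt => /predU1P[->|pq].
  by rewrite set_itv1 Rintegral_set1 !subrr mulr0 mulr0 mul0r addr0.
pose G (t : R) : R := m * t + k / 2 * t ^+ 2.
have dG (t : R) : is_derive t 1 G (m + k * t).
  rewrite /G; apply: is_derive_eq.
  rewrite /GRing.scale/=; lra.
have cG : continuous G.
  by move=> t; apply/differentiable_continuous/derivable1_diffP; have [] := dG t.
rewrite /Rintegral (@continuous_FTC2 _ (fun t => m + k * t) G p q)//=.
- by rewrite /G; lra.
- apply: continuous_subspaceT => t; apply: cvgD; first exact: cvg_cst.
  by apply: cvgM; [exact: cvg_cst|exact: cvg_id].
- split.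
  + by move=> t _; have [] := dG t.
  + by apply: cvg_at_right_filter; exact: cG.
  + by apply: cvg_at_left_filter; exact: cG.
- by move=> t _; rewrite derive1E; apply: derive_val.
Qed.

End slopes.

(** * Slope bounds for [g] and the trapezoid estimate *)

Section trapezoid.
Variable R : realType.
Local Notation mu := (@lebesgue_measure R).

Lemma absolutely_continuous_slope (a b c C : R) (g : R -> R) : a < b ->
  absolutely_continuous a b g ->
  {ae mu, forall t, a <= t <= b -> c <= g^`()%classic t <= C} ->
  forall x y, a <= x -> x <= y -> y <= b ->
    c * (y - x) <= g y - g x <= C * (y - x).
Proof.
move=> ab acg g_bnd; have ab' := ltW ab.
have [h fh] := ac_line_density ab' (absolutely_continuous_clamp ab' acg).
have h_bnd : {ae mu, forall t, a < t < b -> c <= h t <= C}.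
  move: g_bnd (has_density_derive fh).
  apply: filterS2; first exact: (ae_filter_ringOfSetsType mu).
  move=> t g_bnd fht /andP[at_ tb]; rewrite -fht ?at_//.
  (* At an interior point the clamped extension coincides with [g] on a neighbourhood, so the two
     derivatives agree. *)
  rewrite (_ : _^`()%classic t = g^`()%classic t).
    by apply: g_bnd; rewrite !ltW.
  rewrite !derive1E; apply: near_eq_derive; near=> u.
  rewrite /= clamp_id//; apply/andP; split; apply: ltW.
  - by near: u; exact: lt_nbhsr.
  - by near: u; exact: lt_nbhsl.
move=> x y ax xy yb.
have gE z : a <= z <= b -> (g \o clamp a b) z = g z.
  by move=> zab; rewrite /= clamp_id.
have [axb ayb] : a <= x <= b /\ a <= y <= b by lra.
rewrite -(gE x)// -(gE y)//; apply/andP; split; last first.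
  apply: (has_density_le fh) => //; move: h_bnd.
  apply: filterS; first exact: (ae_filter_ringOfSetsType mu).
  by move=> t h_bnd /h_bnd/andP[].
(* The lower bound is the upper bound for [0 - f], whose density is [0 - h]. *)
have zero_dens : has_density a b (cst 0) (cst 0 : R -> R).
  split; first exact: integrable0.
  by move=> *; rewrite Rintegral_cst//= mul0r subrr.
rewrite -lerN2 -mulNr opprB.
have := has_density_le (has_densityB zero_dens fh) (c := - c).
move=> /(_ _ x y ax xy yb); rewrite /= !sub0r => H.
apply: le_trans (H _); first lra.
move: h_bnd; apply: filterS; first exact: (ae_filter_ringOfSetsType mu).
by move=> t h_bnd /h_bnd/andP[? _]; lra.
Unshelve. all: by end_near. Qed.

(* Both affine majorants of [g] are used: the one through [(a, g a)] of slope
   [C] up to their crossing point [a + l], and the one through [(b, g b)] of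
   slope [c] beyond it. *)
Lemma Rintegral_le_trapezoid (a b c C l : R) (g : R -> R) : a < b ->
  mu.-integrable `[a, b] (EFin \o g) ->
  (forall x y, a <= x -> x <= y -> y <= b ->
    c * (y - x) <= g y - g x <= C * (y - x)) ->
  0 <= l <= b - a -> g b - g a = c * (b - a) + (C - c) * l ->
  \int[mu]_(t in `[a, b]) g t <=
    (b - a) * (g a + g b) / 2 + (C - c) / 2 * l * (b - a - l).
Proof.
move=> ab gi g_slope /andP[l0 lba] gab.
pose p := a + l.
have ap : a <= p by rewrite /p; lra.
have pb : p <= b by rewrite /p; lra.
have affine_i m k u v : u <= v ->
    mu.-integrable `[u, v] (EFin \o (fun t => m + k * t)).
  move=> uv; apply: continuous_compact_integrable.
    exact: segment_compact.
  apply: continuous_subspaceT => t; apply: cvgD; first exact: cvg_cst.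
  by apply: cvgM; [exact: cvg_cst|exact: cvg_id].
have gap : mu.-integrable `[a, p] (EFin \o g).
  by apply: integrableS gi => //; apply: subset_itvl; rewrite bnd_simp.
have gpb : mu.-integrable `[p, b] (EFin \o g).
  by apply: integrableS gi => //; apply: subset_itvr; rewrite bnd_simp.
have -> : \int[mu]_(t in `[a, b]) g t =
    \int[mu]_(t in `[a, p]) g t + \int[mu]_(t in `[p, b]) g t.
  rewrite -[X in _ = _ + X]Rintegral_itv_obnd_cbnd; last first.
    by apply: integrableS gpb => //; apply: subset_itvr; rewrite bnd_simp.
  by rewrite -(@Rintegral_itvB _ g (BLeft a) (BRight b) p)// addrC subrK.
have le1 : \int[mu]_(t in `[a, p]) g t <=
    \int[mu]_(t in `[a, p]) (g a - C * a + C * t).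
  apply: le_Rintegral => //; first exact: affine_i.
  move=> t; rewrite /= in_itv/= => /andP[at_ tp].
  by have := g_slope a t (lexx a) at_ (le_trans tp pb); lra.
have le2 : \int[mu]_(t in `[p, b]) g t <=
    \int[mu]_(t in `[p, b]) (g b - c * b + c * t).
  apply: le_Rintegral => //; first exact: affine_i.
  move=> t; rewrite /= in_itv/= => /andP[pt tb].
  by have := g_slope t b (le_trans ap pt) tb (lexx b); lra.
apply: le_trans (lerD le1 le2) _; rewrite !Rintegral_affine//.
have -> : g b = g a + c * (b - a) + (C - c) * l by lra.
by rewrite /p le_eqVlt; apply/orP; left; apply/eqP; field.
Qed.

Lemma trapezoid_dist_le (a b c C l : R) (g : R -> R) : a < b -> c < C ->
  mu.-integrable `[a, b] (EFin \o g) ->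
  (forall x y, a <= x -> x <= y -> y <= b ->
    c * (y - x) <= g y - g x <= C * (y - x)) ->
  l = (g b - g a - c * (b - a)) / (C - c) ->
  `| (b - a)^-1 * \int[mu]_(t in `[a, b]) g t - (g a + g b) / 2 | <=
    (C - c) / 2 * l * ((b - a - l) / (b - a)).
Proof.
move=> ab cC gi g_slope lE.
have ba0 : 0 < b - a by lra.
have gab : g b - g a = c * (b - a) + (C - c) * l.
  by rewrite lE; field; rewrite gt_eqF// subr_gt0.
have l_bnd : 0 <= l <= b - a.
  have := g_slope a b (lexx a) (ltW ab) (lexx b); rewrite gab => /andP[h1 h2].
  apply/andP; split; rewrite -(@ler_pM2l _ (C - c)); lra.
have up := Rintegral_le_trapezoid ab gi g_slope l_bnd gab.
have lo : \int[mu]_(t in `[a, b]) (- g t) <=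
    (b - a) * (- g a + - g b) / 2 + (C - c) / 2 * l * (b - a - l).
  (* For [- g] the slopes lie between [- C] and [- c], and the majorants cross at distance
     [b - a - l] from [a]. The error term is symmetric under exchanging [l] and [b - a - l]. *)
  rewrite (_ : (C - c) / 2 * l * (b - a - l) =
    (- c - - C) / 2 * (b - a - l) * (b - a - (b - a - l))); last by field.
  apply: (@Rintegral_le_trapezoid a b (- C) (- c) _ (fun t => - g t)) => //.
  - rewrite (_ : _ \o _ = \- (EFin \o g))%E; last by apply/funext => t /=.
    exact: integrableN.
  - by move=> x y ax xy yb; have := g_slope x y ax xy yb; lra.
  - by move: l_bnd; lra.
  - by lra.
have NE : \int[mu]_(t in `[a, b]) (- g t) = - \int[mu]_(t in `[a, b]) g t.
  by under eq_Rintegral do rewrite -mulN1r; rewrite RintegralZl// mulN1r.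
rewrite NE in lo.
set I := \int[mu]_(t in _) g t in up lo *.
rewrite -(@ler_pM2r _ (b - a))// -[X in _ * X <= _](gtr0_norm ba0) -normrM.
rewrite [leRHS](_ : _ = (C - c) / 2 * l * (b - a - l)); last first.
  by field; rewrite gt_eqF.
rewrite [X in `|X|](_ : _ = I - (b - a) * (g a + g b) / 2); last first.
  by field; rewrite gt_eqF.
by rewrite ler_norml; apply/andP; split; lra.
Qed.

End trapezoid.

Theorem corollary1 (R : realType) (a b gamma Gamma : R) (g : R -> R)
    (hab : a < b) (hgG : gamma < Gamma)
    (hac : absolutely_continuous a b g)
    (hbound : {ae (@lebesgue_measure R), forall t : R,
        a <= t <= b -> gamma <= (g^`())%classic t <= Gamma})
    (hint : forall x : R, a <= x <= b ->
        (@lebesgue_measure R).-integrable `[a, b]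
          (fun t : R => ((x - t) * (g^`())%classic t)%:E)) :
  let lambda := (g b - g a - gamma * (b - a)) / (Gamma - gamma) in
  (forall x : R, a <= x <= b ->
     `| (b - a)^-1 * (\int[@lebesgue_measure R]_(t in `[a, b]) g t)
        - ((x - a) * g a + (b - x) * g b) / (b - a)
        - (g b - g a) / (b - a) * (x - (a + b) / 2) |
       <= (Gamma - gamma) / 2 * lambda * ((b - a - lambda) / (b - a))
       <= (Gamma - gamma) * (b - a) / 8) /\
  `| (b - a)^-1 * (\int[@lebesgue_measure R]_(t in `[a, b]) g t)
     - (g a + g b) / 2 |
    <= (Gamma - gamma) / 2 * lambda * ((b - a - lambda) / (b - a))
    <= (Gamma - gamma) * (b - a) / 8.
Proof.
move=> lambda.
have ba0 : 0 < b - a by lra.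
have ba_neq0 : b - a != 0 by rewrite gt_eqF.
have g_slope := absolutely_continuous_slope hab hac hbound.
have g_int : lebesgue_measure.-integrable `[a, b] (EFin \o g).
  have acf := absolutely_continuous_clamp (ltW hab) hac.
  (* The clamped extension is continuous, hence integrable on the compact interval, where it equals
     [g]. *)
  have fi : (@lebesgue_measure R).-integrable `[a, b] (EFin \o (g \o clamp a b)).
    apply: continuous_compact_integrable; first exact: segment_compact.
    exact/continuous_subspaceT/ac_line_continuous.
  apply: eq_integrable fi; first exact: measurable_itv.
  by move=> t /set_mem; rewrite /= in_itv/= => tab; rewrite clamp_id.
have main := trapezoid_dist_le hab hgG g_int g_slope (erefl lambda).
have le8 : (Gamma - gamma) / 2 * lambda * ((b - a - lambda) / (b - a)) <=
    (Gamma - gamma) * (b - a) / 8.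
  rewrite -subr_ge0.
  (* Completing the square: the gap is zero exactly when [lambda] is half of [b - a]. *)
  rewrite (_ : _ - _ = (Gamma - gamma) / 2 * ((b - a) / 2 - lambda) ^+ 2 / (b - a)).
    apply: divr_ge0; [apply: mulr_ge0; [lra|exact: sqr_ge0]|exact: ltW].
  by field.
split; last by rewrite main.
move=> x _; rewrite le8 andbT.
rewrite [X in `|X|](_ : _ = (b - a)^-1 *
  (\int[lebesgue_measure]_(t in `[a, b]) g t) - (g a + g b) / 2) ?main//.
by field.
Qed.
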